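(* Let $\mathcal{H}$ be a real Hilbert space, $A,B:\mathcal{H}\to2^{\mathcal{H}}$ set-valued maximally monotone operators and $C:\mathcal{H}\to\mathcal{H}$ a $\beta$-cocoercive operator with $\beta>0$, and consider the inclusion problem $$\text{find }x\in\mathcal{H}\text{ such that }0\in A(x)+B(x)+C(x).\qquad(\ast)$$ Let $\alpha>2$, $x_0,x_1\in\mathcal{H}$, $0<\gamma\le2\beta$ and $0<s\le 2-\frac{\gamma}{2\beta}$. Let $$T_{DY}:=J_{\gamma A}\circ(2J_{\gamma B}-\mathrm{Id}-\gamma C\circ J_{\gamma B})+\mathrm{Id}-J_{\gamma B},$$ and for every $k\ge1$ set $$x_{k+1}:=\left(1-\frac{s\alpha}{2(k+\alpha)}\right)x_k+\frac{(1-s)k}{k+\alpha}(x_k-x_{k-1})+\frac{s\alpha}{2(k+\alpha)}T_{DY}(x_k)+\frac{sk}{k+\alpha}\bigl(T_{DY}(x_k)-T_{DY}(x_{k-1})\bigr).$$ Then the following statements are true: (i) $(x_k)_{k\ge0}$ converges weakly to an element $x_*$ in $\mathrm{Fix}\,T_{DY}$ such that $J_{\gamma B}(x_* )$ is a solution of $(\ast)$; (ii) $\|x_k-x_{k-1}\|=o\left(\frac1k\right)$ and $\|x_{k-1}-T_{DY}(x_{k-1})\|=o\left(\frac1k\right)$ as $k\to+\infty$.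
   Context: $\mathrm{Id}$ is the identity on $\mathcal{H}$. For a maximally monotone operator $M:\mathcal{H}\to2^{\mathcal{H}}$ and $\gamma>0$, $J_{\gamma M}:=(\mathrm{Id}+\gamma M)^{-1}:\mathcal{H}\to\mathcal{H}$ is the resolvent of $\gamma M$. $C$ is $\beta$-cocoercive if $\langle x-y,C(x)-C(y)\rangle\ge\beta\|C(x)-C(y)\|^2$ for all $x,y\in\mathcal{H}$. Convention: if $C\equiv0$ one takes $\beta:=+\infty$, so that $\gamma>0$ is arbitrary and the condition on $s$ reads $0<s\le2$. $\mathrm{Fix}\,T_{DY}:=\{x\in\mathcal{H}:x=T_{DY}(x)\}$. For a real sequence $(a_k)$, $a_k=o(1/k)$ means $k\,a_k\to0$ as $k\to+\infty$.
   Formalization: The inclusion problem (∗) is additionally assumed to have at least one solution; without this, (i) fails, e.g. for H = ℝ, A = 0, B ≡ {1}, C = 0, where T_DY(x) = x − γ has no fixed point. *)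

(* Defs.v *)
From mathcomp Require Import all_boot all_order all_algebra.
From mathcomp Require Import all_classical all_reals all_analysis.

Set Implicit Arguments.
Unset Strict Implicit.
Unset Printing Implicit Defensive.

Import Order.TTheory GRing.Theory Num.Theory.
Import numFieldNormedType.Exports.

Local Open Scope classical_set_scope.
Local Open Scope ring_scope.

(* A real Hilbert space is a complete normed space [H] over [R : realType]
   together with an inner product, i.e. a positive definite symmetric bilinear
   form [{dot H for idfun}], that induces the norm of [H]. *)
Definition induces_norm (R : realType) (H : completeNormedModType R)
    (dot : {dot H for idfun}) : Prop :=
  forall x : H, dot x x = `|x| ^+ 2.

Section Operators.
Variables (R : realType) (H : completeNormedModType R).
Variable dot : {dot H for idfun}.
Implicit Types (A B M : H -> set H) (C : H -> H).

Definition weakly_converges (x : nat -> H) (l : H) : Prop :=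
  forall y : H, (fun k => dot (x k) y) @ \oo --> dot l y.

Definition monotone_op M : Prop :=
  forall x y u v : H, M x u -> M y v -> 0 <= dot (x - y) (u - v).

Definition maximally_monotone M : Prop :=
  monotone_op M /\
  forall M', monotone_op M' ->
    (forall x, M x `<=` M' x) -> forall x, M' x `<=` M x.

(* The parameter [+oo] is reserved for the zero operator: this is the
   convention [beta = +oo] when [C] vanishes identically. Nonzero constant
   operators, although cocoercive for every finite [beta], are not
   [+oo]-cocoercive. *)
Definition cocoercive (beta : \bar R) C : Prop :=
  match beta with
  | r%:E => forall x y : H, r * `|C x - C y| ^+ 2 <= dot (x - y) (C x - C y)
  | +oo%E => forall x : H, C x = 0
  | -oo%E => False
  end.

(* [(Id + gamma M)^-1]; the default value [0] of [xget] plays no role when [M]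
   is maximally monotone and [gamma > 0], by Minty's theorem. *)
Definition resolvent (gamma : R) M (x : H) : H :=
  xget 0 [set y | exists2 u, M y u & y + gamma *: u = x].

Definition solution A B C (x : H) : Prop :=
  exists u v : H, [/\ A x u, B x v & u + v + C x = 0].

Definition T_DY (gamma : R) A B C (x : H) : H :=
  let JB := resolvent gamma B in
  resolvent gamma A (2 *: JB x - x - gamma *: C (JB x)) + x - JB x.

End Operators.

(* [a k = o(1/k)] as [k] tends to infinity *)
Definition is_o_inv (R : realType) (a : nat -> R) : Prop :=
  (fun k => k%:R * a k) @ \oo --> (0 : R).

(* Main.v *)
Require Import Defs.
From mathcomp Require Import all_boot all_order all_algebra.
From mathcomp Require Import all_classical all_reals all_analysis.
From mathcomp Require Import ring lra.

Set Implicit Arguments.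
Unset Strict Implicit.
Unset Printing Implicit Defensive.

Import Order.TTheory GRing.Theory Num.Theory.
Import numFieldNormedType.Exports.

Local Open Scope classical_set_scope.
Local Open Scope ring_scope.

(* Put [F := s (Id - T_DY)]. The Davis-Yin computation shows that [F] is
   1/2-cocoercive, and the recurrence becomes, with [D_k := x_k - x_(k-1)],
     (k + alpha) D_(k+1)
       = k D_k - (alpha / 2) F x_k - k (F x_k - F x_(k-1)).
   For a zero [z] of [F] and [1 < l < alpha - 1], the energy
     E_l(k) = 2 l p_k + h_k,
     p_k = (alpha - 1) |x_k - z|^2 + 2 k <x_k - z, D_k + F x_(k-1)>,
     h_k = (k^2 / 2) (|2 D_k + F x_(k-1)|^2 + |F x_(k-1)|^2)
   is eventually nonnegative and decreases by at least a multiple of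
   [h_(k+1) / k]: the terms in [F x_k - F x_(k-1)] add up to
   [k^2 (|F x_k - F x_(k-1)|^2 - 2 <D_k, F x_k - F x_(k-1)>)], which is
   nonpositive by cocoercivity. Since [E_l] is affine in [l], two values of [l]
   make [p_k] and [h_k] converge separately; the decrease forces [h_k] to [0],
   which gives the rates, and then [|x_k - z|] converges, so that Opial's
   argument applies. *)

(** * Real sequences and abstract minimisation *)

Lemma eventually_nonincreasing_cvg (R : realType) (u : nat -> R) (N : nat) :
  (forall n, (N <= n)%N -> u n.+1 <= u n) ->
  (forall n, (N <= n)%N -> 0 <= u n) ->
  exists l : R, u @ \oo --> l.
Proof.
move=> dec u0; suff : cvg ((fun n => u (n + N)%N) @ \oo).
  by move/cvg_ex => [l hl]; exists l; rewrite -(cvg_shiftn N).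
apply: nonincreasing_is_cvgn.
  by apply/nonincreasing_seqP => n; rewrite addSn; apply: dec; rewrite leq_addl.
by exists 0 => _ [n _ <-]; apply: u0; rewrite leq_addl.
Qed.

(* Summing the decrease over the block [n, 2n + 1] replaces the divergence of
   the harmonic series. *)
Lemma harmonic_decrease_cvg0 (R : realType) (e h : nat -> R) (c l L : R)
    (N : nat) :
  0 < c -> (forall n, 0 <= h n) ->
  (forall n, (N <= n)%N -> e n.+1 <= e n - c * h n.+1 / n.+1%:R) ->
  e @ \oo --> l -> h @ \oo --> L -> h @ \oo --> 0.
Proof.
move=> c0 h0 dec el hL.
have [<-//|L0] : L = 0 \/ 0 < L.
  have : 0 <= L by apply: (ler_cvg_to (cvg_cst 0) hL); apply: nearW.
  by rewrite le_eqVlt => /orP[/eqP ->|]; [left|right].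
(* Past [n], [h] is at least [L / 2] and the indices of the block are at most [2 (n + 1)], so each
   step costs at least [a / (n + 1)]. The [n + 1] steps cost [a], yet both ends lie within [a / 2]
   of [l]. *)
exfalso; pose a := c * L / 4.
have a0 : 0 < a by rewrite divr_gt0 ?mulr_gt0.
have [N1 _ H1] : \forall n \near \oo, `|L - h n| < L / 2.
  by move/cvgrPdist_lt : hL; apply; lra.
have [N2 _ H2] : \forall n \near \oo, `|l - e n| < a / 2.
  by move/cvgrPdist_lt : el; apply; lra.
pose n := maxn N (maxn N1 N2).
have nN : (N <= n)%N by rewrite leq_maxl.
have nN1 : (N1 <= n)%N by rewrite leq_max leq_maxl orbT.
have nN2 : (N2 <= n)%N by rewrite !leq_max leqnn !orbT.
have n0 : 0 < n.+1%:R :> R by rewrite ltr0n.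
have block j : (j <= n.+1)%N -> e (n + j)%N <= e n - j%:R * (a / n.+1%:R).
  elim: j => [|j IH] jn; first by rewrite addn0 mul0r subr0.
  have := dec (n + j)%N (leq_trans nN (leq_addr _ _)).
  rewrite addnS => h1; apply: le_trans h1 _.
  have h2 : L / 2 <= h (n + j).+1.
    have /H1 /= : (N1 <= (n + j).+1)%N.
      by rewrite (leq_trans nN1) // (leq_trans (leq_addr j n)).
    by rewrite ltr_norml => /andP[_]; lra.
  have h3 : (n + j).+1%:R <= 2 * n.+1%:R :> R.
    rewrite -natrM ler_nat mul2n -addnn -addnS.
    exact: leq_add (leqnSn n) jn.
  have h4 : a / n.+1%:R <= c * h (n + j).+1 / (n + j).+1%:R.
    rewrite ler_pdivlMr ?ltr0n // mulrAC ler_pdivrMr //.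
    apply: le_trans (ler_wpM2l (ltW a0) h3) _.
    have -> : a * (2 * n.+1%:R) = c * (L / 2) * n.+1%:R by rewrite /a; field.
    by rewrite ler_wpM2r ?(ltW n0) // ler_pM2l.
  have := IH (ltnW jn); rewrite -[j.+1%:R]natr1 mulrDl mul1r.
  move: h4; move: (a / _) (c * _ / _) => ? ?; lra.
have := block n.+1 (leqnn _); rewrite mulrC divfK ?gt_eqF //.
have /H2 /= := nN2; have /H2 /= : (N2 <= n + n.+1)%N.
  by rewrite (leq_trans nN2) // leq_addr.
rewrite !ltr_norml => /andP[_ ?] /andP[? _]; lra.
Qed.

Lemma near_lt_invS (R : realType) (e : R) : 0 < e ->
  \forall n \near \oo, n.+1%:R^-1 < e.
Proof.
move=> e0; have [N _ HN] := near_infty_natSinv_lt (PosNum e0).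
by exists N => // n /HN.
Qed.

(** Letting [t] tend to 0; this extracts first-order conditions from one-sided perturbations. *)
Lemma ge0_of_affine (R : realType) (a b : R) :
  (forall t, 0 < t <= 1 -> 0 <= a + t * b) -> 0 <= a.
Proof.
move=> h; rewrite leNgt; apply/negP => a0.
have := h 1 ltac:(by rewrite ltr01 lexx); rewrite mul1r => h1.
have b0 : 0 < b by lra.
have /h : 0 < - a / (2 * b) <= 1.
  rewrite divr_gt0 /=; [|lra|lra].
  by rewrite ler_pdivrMr; lra.
have -> : - a / (2 * b) * b = - a / 2 by field; rewrite gt_eqF.
lra.
Qed.

(** The last hypothesis is an abstract strong convexity: [v r] is at least the infimum, so [d] is
    bounded by the mean of the two optimality gaps. Minimizing sequences are therefore Cauchy when
    [d] is a multiple of a squared distance. *)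
Lemma minimizing_sequence (R : realType) (T : Type) (S : set T) (v : T -> R)
    (d : T -> T -> R) (m0 : R) :
  S !=set0 -> (forall p, S p -> m0 <= v p) ->
  (forall p q, S p -> S q -> exists2 r, S r & v r + d p q <= (v p + v q) / 2) ->
  exists (p : nat -> T) (m : R),
    [/\ forall n, S (p n), forall q, S q -> m <= v q,
        forall n, v (p n) <= m + n.+1%:R^-1
      & forall n k, d (p n) (p k) <= n.+1%:R^-1 + k.+1%:R^-1].
Proof.
move=> [t0 St0] vm0 hmid; pose m := inf (v @` S).
have hinf : has_inf (v @` S).
  split; first by exists (v t0), t0.
  by exists m0 => _ [t St <-]; exact: vm0.
have mle q : S q -> m <= v q.
  by move=> Sq; apply: (ge_inf hinf.2); exists q.
have /choice[p hp] : forall n : nat, exists t, S t /\ v t <= m + n.+1%:R^-1.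
  move=> n; have [_ [t St <-] /ltW vt] :=
    inf_adherent (ltac:(by rewrite invr_gt0) : 0 < n.+1%:R^-1 :> R) hinf.
  by exists t.
exists p, m; split => //; [by move=> n; case: (hp n)..|].
move=> n k; have [Sn vn] := hp n; have [Sk vk] := hp k.
have [r /mle mr hr] := hmid _ _ Sn Sk.
have : 0 < n.+1%:R^-1 :> R by rewrite invr_gt0.
have : 0 < k.+1%:R^-1 :> R by rewrite invr_gt0.
by move: (n.+1%:R^-1) (k.+1%:R^-1) vn vk => e e' vn vk *; lra.
Qed.

(** * Inner products and Minty's theorem *)

Section InnerProduct.
Variables (R : realType) (H : completeNormedModType R).
Variable dot : {dot H for idfun}.
Hypothesis hdot : induces_norm dot.

Lemma dotC (x y : H) : dot x y = dot y x.
Proof. by rewrite (hermC dot) expr0 mul1r. Qed.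

Lemma dotZl (a : R) (x y : H) : dot (a *: x) y = a * dot x y.
Proof. exact: linearZl_LR. Qed.

Lemma dotZr (a : R) (x y : H) : dot x (a *: y) = a * dot x y.
Proof. exact: linearZr_LR. Qed.

Lemma dotDl (x y z : H) : dot (x + y) z = dot x z + dot y z.
Proof. exact: linearDl. Qed.

Lemma dotDr (x y z : H) : dot x (y + z) = dot x y + dot x z.
Proof. exact: linearDr. Qed.

Lemma dotNl (x y : H) : dot (- x) y = - dot x y.
Proof. exact: linearNl. Qed.

Lemma dotNr (x y : H) : dot x (- y) = - dot x y.
Proof. exact: linearNr. Qed.

Lemma dot0l (x : H) : dot 0 x = 0.
Proof. exact: linear0l. Qed.

Lemma dot0r (x : H) : dot x 0 = 0.
Proof. exact: linear0r. Qed.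

Definition dotE := (dotDl, dotDr, dotNl, dotNr, dotZl, dotZr, dot0l, dot0r).

Lemma dot_ge0 (x : H) : 0 <= dot x x.
Proof. by rewrite hdot sqr_ge0. Qed.

Lemma dot_eq0 (x : H) : dot x x <= 0 -> x = 0.
Proof.
move=> h; apply/eqP; rewrite -normr_eq0 -sqrf_eq0 -hdot eq_le h.
exact: dot_ge0.
Qed.

(** Testing against all vectors turns vector identities into scalar ones, within reach of [lra] and
    [field]. *)
Lemma dot_ext (x y : H) : (forall w, dot x w = dot y w) -> x = y.
Proof.
move=> h; apply/eqP; rewrite -subr_eq0; apply/eqP/dot_eq0.
by rewrite dotDl dotNl h subrr.
Qed.

Lemma norm_lt_dot (x : H) (e : R) : 0 < e -> (`|x| < e) = (dot x x < e ^+ 2).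
Proof. by move=> e0; rewrite hdot ltr_pXn2r // nnegrE ?normr_ge0 // ltW. Qed.

Lemma dot_sqr_le (x y : H) : dot x y ^+ 2 <= dot x x * dot y y.
Proof.
have [->|x0] := eqVneq x 0; first by rewrite !dotE expr0n mul0r.
have xx : 0 < dot x x by rewrite hdot exprn_gt0 ?normr_gt0.
have := dot_ge0 (dot x y *: x - dot x x *: y).
rewrite !dotE (dotC y x) => h.
by rewrite -(ler_pM2l xx); nra.
Qed.

Lemma cauchy_schwarz (x y : H) : `|dot x y| <= `|x| * `|y|.
Proof.
rewrite -(@ler_pXn2r _ 2%N) ?nnegrE ?mulr_ge0 // exprMn -!hdot.
by rewrite real_normK ?num_real // dot_sqr_le.
Qed.

Lemma cvg_dotl (p : nat -> H) (a y : H) :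
  p @ \oo --> a -> (fun n => dot (p n) y) @ \oo --> dot a y.
Proof.
move=> pa; apply/cvgrPdist_lt => e e0.
have y1 : 0 < `|y| + 1 by rewrite ltr_wpDl.
move/cvgrPdist_lt : pa => /(_ _ (divr_gt0 e0 y1)).
apply: filterS => n h; rewrite -dotNl -dotDl.
rewrite (le_lt_trans (cauchy_schwarz _ _)) //.
move: h; rewrite ltr_pdivlMr // => /(le_lt_trans _); apply.
by rewrite ler_wpM2l // lerDl.
Qed.

Lemma cvg_dotr (p : nat -> H) (a y : H) :
  p @ \oo --> a -> (fun n => dot y (p n)) @ \oo --> dot y a.
Proof.
move=> pa; rewrite dotC; under eq_fun do rewrite dotC; exact: cvg_dotl.
Qed.

Lemma cvg_dot_sqr (p : nat -> H) (a : H) :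
  p @ \oo --> a -> (fun n => dot (p n) (p n)) @ \oo --> dot a a.
Proof.
move=> pa; under eq_fun do rewrite hdot.
by rewrite hdot; apply: cvgM; apply: cvg_norm.
Qed.

Lemma cvg_of_sqr_dist (p : nat -> H) :
  (forall n k, dot (p n - p k) (p n - p k)
     <= 8 * (n.+1%:R^-1 + k.+1%:R^-1)) ->
  exists a : H, p @ \oo --> a.
Proof.
move=> h; suff : cvg (p @ \oo) by move/cvg_ex.
apply: cauchy_cvg; apply/(@cauchy_exP R H) => e e0.
have e1 : 0 < e ^+ 2 / 16 by rewrite divr_gt0 ?exprn_gt0.
have [N _ HN] := near_lt_invS e1.
exists (p N); exists N => // n /= Nn; rewrite -ball_normE /= norm_lt_dot //.
apply: le_lt_trans (h _ _) _.
move: (HN _ (leqnn N)) (HN _ Nn) => /=.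
by move: (N.+1%:R^-1) (n.+1%:R^-1) => a b; lra.
Qed.

Lemma midpoint_dot (x y : H) :
  dot (2^-1 *: (x + y)) (2^-1 *: (x + y)) + dot (x - y) (x - y) / 4
  = (dot x x + dot y y) / 2.
Proof. by rewrite !dotE (dotC y x); lra. Qed.

(** Adding the pair [(a, b)] to the graph of [M] keeps it monotone, so maximality already contains
    it. *)
Lemma maximal_mem (M : H -> set H) (a b : H) : maximally_monotone dot M ->
  (forall y u, M y u -> 0 <= dot (a - y) (b - u)) -> M a b.
Proof.
move=> [Mm Mx] h.
apply: (Mx (fun x v => M x v \/ (x = a /\ v = b))); last by right.
- move=> x y u v [Mxu|[-> ->]] [Myv|[-> ->]].
  + exact: Mm.
  + by have := h _ _ Mxu; rewrite !dotE => ?; lra.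
  + exact: h.
  + by rewrite !subrr dot0l.
- by move=> x v Mxv; left.
Qed.

(** The epigraph of the Fitzpatrick function of [M]; as an epigraph it needs neither suprema nor
    infinite values. *)
Let fitz (M : H -> set H) : set (H * H * R) := [set p | forall y u, M y u ->
  dot p.1.1 u + dot y p.1.2 - dot y u <= p.2].

(** Otherwise the point is monotonically related to the graph of [M], hence lies on it, and the
    defining inequality at that very point gives a contradiction. *)
Let fitz_ge (M : H -> set H) p : maximally_monotone dot M -> fitz M p ->
  dot p.1.1 p.1.2 <= p.2.
Proof.
move=> Mm Fp; rewrite leNgt; apply/negP => lt.
have /Fp : M p.1.1 p.1.2.
  apply: maximal_mem => // y u /Fp; rewrite !dotE; lra.
lra.
Qed.

(* Minimise the Fitzpatrick function of [M] plus half the squared norm: strong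
   convexity yields a minimiser without any weak compactness, and the
   optimality condition places it on the graph of [M] and of [- Id]. *)
Lemma minty0 (M : H -> set H) : maximally_monotone dot M ->
  exists a, M a (- a).
Proof.
move=> Mm.
pose v (p : H * H * R) := p.2 + (dot p.1.1 p.1.1 + dot p.1.2 p.1.2) / 2.
pose d (p q : H * H * R) := (dot (p.1.1 - q.1.1) (p.1.1 - q.1.1)
  + dot (p.1.2 - q.1.2) (p.1.2 - q.1.2)) / 8.
have graphF y u : M y u -> fitz M (y, u, dot y u).
  move=> Myu z w Mzw /=; have := Mm.1 _ _ _ _ Myu Mzw; rewrite !dotE; lra.
have fitzC p q t : 0 <= t <= 1 -> fitz M p -> fitz M q ->
    fitz M ((1 - t) *: p.1.1 + t *: q.1.1, (1 - t) *: p.1.2 + t *: q.1.2,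
            (1 - t) * p.2 + t * q.2).
  move=> /andP[t0 t1] Fp Fq y u Myu; have := Fp _ _ Myu; have := Fq _ _ Myu.
  rewrite /= !dotE => h1 h2; nra.
have [|||p [m [Sp mle vp dp]]] :=
  @minimizing_sequence R _ (fitz M) v d 0.
- have [[y [u Myu]]|nM] := pselect (exists y u, M y u).
    by eexists; exact: (graphF _ _ Myu).
  by exists (0, 0, 0) => y u Myu; case: nM; exists y, u.
- move=> p Fp; rewrite /v; have := fitz_ge Mm Fp.
  have := dot_ge0 (p.1.1 + p.1.2); rewrite !dotE (dotC p.1.2 p.1.1); lra.
- move=> p q Fp Fq; exists (2^-1 *: (p.1.1 + q.1.1), 2^-1 *: (p.1.2 + q.1.2),
    (p.2 + q.2) / 2).
    have := fitzC p q 2^-1 ltac:(lra) Fp Fq.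
    rewrite !scalerDr; congr (fitz M (_ *: _ + _, _ *: _ + _, _)); lra.
  rewrite /v /d /=; have := midpoint_dot p.1.1 q.1.1.
  have := midpoint_dot p.1.2 q.1.2; lra.
have [a pa] : exists a : H, (fun n => (p n).1.1) @ \oo --> a.
  apply: cvg_of_sqr_dist => n k; have := dp n k; rewrite /d.
  have := dot_ge0 ((p n).1.2 - (p k).1.2).
  by move: (n.+1%:R^-1) (k.+1%:R^-1) => e e'; lra.
have [b pb] : exists b : H, (fun n => (p n).1.2) @ \oo --> b.
  apply: cvg_of_sqr_dist => n k; have := dp n k; rewrite /d.
  have := dot_ge0 ((p n).1.1 - (p k).1.1).
  by move: (n.+1%:R^-1) (k.+1%:R^-1) => e e'; lra.
(* Chosen so that [v (a, b, t) = m]; the real components of [p n] need not be shown to converge. *)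
pose t := m - (dot a a + dot b b) / 2.
have Fab : fitz M (a, b, t).
  move=> y u Myu /=.
  pose f n := dot (p n).1.1 u + dot y (p n).1.2 - dot y u.
  pose g n := m + n.+1%:R^-1
    - (dot (p n).1.1 (p n).1.1 + dot (p n).1.2 (p n).1.2) * 2^-1.
  have cf : f @ \oo --> dot a u + dot y b - dot y u.
    by apply: cvgB (cvg_cst _); apply: cvgD; [exact: cvg_dotl|exact: cvg_dotr].
  have cg : g @ \oo --> m + 0 - (dot a a + dot b b) * 2^-1.
    apply: cvgB; first by apply: cvgD; [exact: cvg_cst|exact: cvg_harmonic].
    by apply: cvgMl; apply: cvgD; exact: cvg_dot_sqr.
  rewrite -[t]/(m - _) -[m in _ <= m - _]addr0; apply: ler_cvg_to cf cg _.
  apply: nearW => n; rewrite /f /g; have := Sp n _ _ Myu; have := vp n.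
  by rewrite /v; move: (n.+1%:R^-1) => e; lra.
(* First-order optimality of [(a, b, t)] along the segment towards the point [(y, u, dot y u)] of
   the epigraph. *)
have opt y u : M y u ->
    0 <= dot y u - t + dot a y - dot a a + dot b u - dot b b.
  move=> Myu; apply: (@ge0_of_affine _ _
    ((dot (y - a) (y - a) + dot (u - b) (u - b)) / 2)) => c /andP[c0 c1].
  have /mle := fitzC _ _ c ltac:(lra) Fab (graphF _ _ Myu).
  rewrite /v /= => h; rewrite -(ler_pM2l c0).
  by move: h; rewrite !dotE (dotC y a) (dotC u b) /t; lra.
have tab := fitz_ge Mm Fab.
(* By [opt] and [tab], the pairing of [(- b, - a)] with any graph point is at least [|a + b|^2].
   Then [opt] at this new graph point forces [a + b = 0]. *)
have Mba : M (- b) (- a).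
  apply: maximal_mem => // y u /opt; rewrite /= in tab.
  have := dot_ge0 (a + b); rewrite !dotE (dotC b a) (dotC b u) (dotC y a).
  rewrite /t in tab *; lra.
have ba : a + b = 0.
  apply: dot_eq0; have := opt _ _ Mba; rewrite /= in tab.
  rewrite !dotE (dotC b a); lra.
exists a; have -> : a = - b by apply/eqP; rewrite -addr_eq0 ba.
by rewrite opprK; move: Mba; rewrite -(addrK b a) ba add0r opprK.
Qed.

(** The translated operator [gamma M - z] is again maximally monotone, which reduces the claim to
    [minty0]. *)
Lemma minty (M : H -> set H) (gamma : R) (z : H) :
  maximally_monotone dot M -> 0 < gamma ->
  exists y u, M y u /\ y + gamma *: u = z.
Proof.
move=> Mm g0; pose M' y := [set u | M y (gamma^-1 *: (u + z))].
have gN0 : gamma != 0 by rewrite gt_eqF.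
have [|a Ma] := @minty0 M'.
  split.
    move=> x y u v Mxu Myv; have := Mm.1 _ _ _ _ Mxu Myv.
    rewrite -scalerBr dotZr pmulr_rge0 ?invr_gt0 //.
    by rewrite opprD addrACA subrr addr0.
  move=> N Nm MN x u Nxu; apply: (maximal_mem Mm) => y v Myv.
  have /MN Nyv : M' y (gamma *: v - z).
    by rewrite /M' /= subrK scalerA mulVf // scale1r.
  have h := Nm _ _ _ _ Nxu Nyv.
  rewrite -(pmulr_rge0 _ g0) -dotZr scalerBr scalerA mulfV // scale1r.
  by move: h; rewrite opprB addrA.
exists a, (gamma^-1 *: (- a + z)); split => //.
by rewrite scalerA mulfV // scale1r addNKr.
Qed.

Lemma resolvent_spec (M : H -> set H) (gamma : R) (z : H) :
  maximally_monotone dot M -> 0 < gamma ->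
  exists2 u, M (resolvent gamma M z) u & resolvent gamma M z + gamma *: u = z.
Proof.
move=> Mm g0; have [y [u [Myu yu]]] := minty z Mm g0.
by rewrite /resolvent; case: xgetP => [? -> [v]|/(_ y)[]]; [exists v|exists u].
Qed.

Lemma resolvent_eq (M : H -> set H) (gamma : R) (y u : H) :
  maximally_monotone dot M -> 0 < gamma -> M y u ->
  resolvent gamma M (y + gamma *: u) = y.
Proof.
move=> Mm g0 Myu; have [v Mv] := resolvent_spec (y + gamma *: u) Mm g0.
set w := resolvent _ _ _ in Mv *; move=> wv.
apply/eqP; rewrite -subr_eq0; apply/eqP/dot_eq0.
have : w - y = gamma *: (u - v).
  by rewrite scalerBr; apply/eqP; rewrite subr_eq addrAC [_ + y]addrC -wv addrK.
move=> e; have d0 := Mm.1 _ _ _ _ Mv Myu.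
by rewrite {2}e dotZr -(opprB v u) dotNr mulrN oppr_le0 mulr_ge0 // ltW.
Qed.

(** * The Davis-Yin operator *)

Section DavisYin.
Variables (A B : H -> set H) (C : H -> H) (gamma : R).
Hypotheses (hA : maximally_monotone dot A) (hB : maximally_monotone dot B).
Hypothesis gamma0 : 0 < gamma.

Let T := T_DY gamma A B C.
Let J := resolvent gamma B.

(** Unfolds both resolvents into graph points of [A] and [B], so that [z - T z] is [gamma] times an
    element of a sum of values of [A], [B] and [C]. *)
Lemma T_DY_spec z : exists u v, [/\ A (J z + T z - z) u, B (J z) v,
  J z + gamma *: v = z & gamma *: (u + v + C (J z)) = z - T z].
Proof.
have [v Bv zv] := resolvent_spec z hB gamma0.
have [u Au zu] :=
  resolvent_spec (2 *: J z - z - gamma *: C (J z)) hA gamma0.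
exists u, v; rewrite -/J in Bv zv.
have TJ : J z + T z - z = resolvent gamma A (2 *: J z - z - gamma *: C (J z)).
  by apply: dot_ext => w; rewrite /T /T_DY -/J !dotE; lra.
rewrite TJ; split => //; apply: dot_ext => w.
move: (congr1 (dot^~ w) TJ) (congr1 (dot^~ w) zv) (congr1 (dot^~ w) zu).
by rewrite /= !dotE; lra.
Qed.

(** The hypothesis isolates what is asked of [C]. Adding it, for [g] the difference of the
    residuals, to the monotonicity inequalities of [A] and [B] scaled by [gamma] cancels every term
    in [b = J x - J y]. *)
Lemma T_DY_cocoercive (kappa : R) :
  (forall x y g, 0 <= (1 - kappa) * dot g g
     + gamma * (dot (x - y) (C x - C y) - dot g (C x - C y))) ->
  forall x y, kappa * dot (x - T x - (y - T y)) (x - T x - (y - T y))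
    <= dot (x - y) (x - T x - (y - T y)).
Proof.
move=> hC x y.
have [u [v [Au Bv xv ux]]] := T_DY_spec x.
have [u' [v' [Au' Bv' yv uy]]] := T_DY_spec y.
have := hC (J x) (J y) (x - T x - (y - T y)).
have := mulr_ge0 (ltW gamma0) (hA.1 _ _ _ _ Au Au').
have := mulr_ge0 (ltW gamma0) (hB.1 _ _ _ _ Bv Bv').
rewrite -!dotZr.
have -> : gamma *: (v - v') = x - J x - (y - J y).
  apply: dot_ext => w.
  move: (congr1 (dot^~ w) xv) (congr1 (dot^~ w) yv) => /=.
  by rewrite /= !dotE; lra.
have -> : gamma *: (u - u') = (x - T x) - (x - J x) - gamma *: C (J x)
    - ((y - T y) - (y - J y) - gamma *: C (J y)).
  apply: dot_ext => w.
  move: (congr1 (dot^~ w) xv) (congr1 (dot^~ w) yv) => /=.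
  move: (congr1 (dot^~ w) ux) (congr1 (dot^~ w) uy) => /=.
  by rewrite /= !dotE; lra.
set b := J x - J y; set g := x - T x - (y - T y); set c := C (J x) - C (J y).
have -> : x - J x - (y - J y) = x - y - b.
  by apply: dot_ext => w; rewrite /b !dotE; lra.
have -> : J x + T x - x - (J y + T y - y) = b - g.
  by apply: dot_ext => w; rewrite /b /g !dotE; lra.
have -> : (x - T x) - (x - J x) - gamma *: C (J x)
    - ((y - T y) - (y - J y) - gamma *: C (J y))
    = g - (x - y) + b - gamma *: c.
  by apply: dot_ext => w; rewrite /b /g /c !dotE; lra.
move: (x - y) b g c => z b g c.
by rewrite !dotE (dotC g z) (dotC g b); lra.
Qed.

Lemma T_DY_fixed_solution z : z = T z -> solution A B C (J z).
Proof.
move=> zT; have [u [v [Au Bv zv uv]]] := T_DY_spec z.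
exists u, v; split => //; first by move: Au; rewrite -zT addrK.
have : gamma *: (u + v + C (J z)) = 0 by rewrite uv {1}zT subrr.
by move/eqP; rewrite scaler_eq0 gt_eqF //= => /eqP.
Qed.

Lemma solution_T_DY_fixed z : solution A B C z -> exists x, x = T x.
Proof.
move=> [u [v [Au Bv uv]]]; exists (z + gamma *: v).
rewrite /T /T_DY (resolvent_eq hB gamma0 Bv).
have -> : 2 *: z - (z + gamma *: v) - gamma *: C z = z + gamma *: u.
  apply: dot_ext => w; have := congr1 (dot^~ w) uv; rewrite /= !dotE => h.
  have : gamma * (dot u w + dot v w + dot (C z) w) = 0 by rewrite h mulr0.
  lra.
by rewrite (resolvent_eq hA gamma0 Au) [RHS]addrC addKr.
Qed.

End DavisYin.

(** * Asymptotic centres and weak convergence *)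

(** Young's inequality [|a + b|^2 <= (1 + t) |a|^2 + (1 + 1/t) |b|^2], with [e] uniform in [a] and
    [b]. *)
Lemma dot_perturb (m delta : R) : 0 <= m -> 0 < delta ->
  exists2 e, 0 < e & forall a b : H,
    dot a a <= m + e -> dot b b <= e -> dot (a + b) (a + b) <= m + delta.
Proof.
move=> m0 d0; have md : 0 < 3 * m + delta by lra.
(* With this [t] and the [e] below, each of the excess terms [t m], [(1 + t) e] and [(1 + 1/t) e] is
   at most [delta / 3]. *)
pose t := delta / (3 * m + delta).
have t0 : 0 < t by rewrite divr_gt0.
have tm : t * (3 * m + delta) = delta by rewrite /t divfK ?gt_eqF.
have t1 : t <= 1 by rewrite /t ler_pdivrMr // mul1r; lra.
clearbody t; have t3 : 0 < 3 * (1 + t) by lra.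
pose e := t * delta / (3 * (1 + t)).
have et : e * (3 * (1 + t)) = t * delta by rewrite /e divfK // gt_eqF.
have e0 : 0 < e by rewrite /e divr_gt0 // mulr_gt0.
clearbody e; exists e => // a b ha hb.
have := dot_ge0 (t *: a - b); rewrite -(ler_pM2l t0) !dotE (dotC b a) => h.
have h1 := ler_wpM2l (ltW t0) (ler_wpM2l (addr_ge0 ler01 (ltW t0)) ha).
have h2 := ler_wpM2l (addr_ge0 ler01 (ltW t0)) hb.
have h3 : t * delta * t <= t * delta by rewrite ler_piMr // mulr_ge0 // ltW.
have h4 : t * (t * (3 * m)) <= t * delta.
  by rewrite ler_wpM2l ?ltW //; nra.
nra.
Qed.

Section AsymptoticCenter.
Variables (x : nat -> H) (P : nat -> Prop).
Hypothesis freqP : forall N, exists2 n, (N <= n)%N & P n.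

(** The infimum of such [r] is the upper limit of the squared distances to [y] along [P]; this
    replaces subsequences and upper limits. *)
Let ball y r := \forall n \near \oo, P n -> dot (x n - y) (x n - y) <= r.

(** The squared radius is minimised over pairs (centre, radius); the parallelogram identity gives
    the strong convexity. The last clause is quadratic growth, from the midpoint of [y] and [c]. *)
Lemma asymptotic_center : (exists y r, ball y r) ->
  exists c m, [/\ 0 <= m, forall delta, 0 < delta -> ball c (m + delta)
    & forall y r, ball y r -> m + dot (y - c) (y - c) / 2 <= r].
Proof.
move=> [y0 [r0 br0]].
(* Since [P] holds arbitrarily late, the eventual bound is not vacuous. *)
have ball_ge0 y r : ball y r -> 0 <= r.
  move=> [N _ HN]; have [n /HN h /h] := freqP N; apply: le_trans.
  exact: dot_ge0.
have mid y r y' r' : ball y r -> ball y' r' ->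
    ball (2^-1 *: (y + y')) ((r + r') / 2 - dot (y - y') (y - y') / 4).
  apply: filterS2 => n h1 h2 Pn; move: (h1 Pn) (h2 Pn).
  by rewrite !dotE (dotC y' y) (dotC y (x n)) (dotC y' (x n)); lra.
have [|||p [m [Sp mle vp dp]]] := @minimizing_sequence R _
    (fun p : H * R => ball p.1 p.2) snd
    (fun p q => dot (p.1 - q.1) (p.1 - q.1) / 4) 0.
- by exists (y0, r0).
- by move=> p; exact: ball_ge0.
- move=> p q hp hq.
  by eexists (_, _); [exact: mid _ _ _ _ hp hq|rewrite /= subrK].
have [c pc] : exists c : H, (fun n => (p n).1) @ \oo --> c.
  apply: cvg_of_sqr_dist => n k; have := dp n k.
  have : 0 < n.+1%:R^-1 :> R by rewrite invr_gt0.
  have : 0 < k.+1%:R^-1 :> R by rewrite invr_gt0.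
  by move: (n.+1%:R^-1) (k.+1%:R^-1) => e e'; lra.
have m0 : 0 <= m.
  apply/ler_addgt0Pr => e /near_lt_invS [N _ /(_ N (leqnn N)) /= he].
  apply: le_trans (ball_ge0 _ _ (Sp N)) (le_trans (vp N) _).
  by rewrite lerD2l ltW.
have ballc delta : 0 < delta -> ball c (m + delta).
  move=> d0; have [e e0 he] := dot_perturb m0 d0.
  have : (fun n => dot ((p n).1 - c) ((p n).1 - c)) @ \oo --> 0.
    rewrite -(dot0l (0 : H)); apply: cvg_dot_sqr.
    by rewrite -(subrr c); apply: cvgB pc _; exact: cvg_cst.
  move/cvgrPdist_lt => /(_ _ e0) [N1 _ h1].
  have [N2 _ h2] := near_lt_invS e0.
  pose k := maxn N1 N2.
  have /= {}h1 := h1 k (leq_maxl _ _).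
  have /= {}h2 := h2 k (leq_maxr _ _).
  have := Sp k; apply: filterS => n h /h {}h.
  rewrite -(subrKA (p k).1); apply: he.
    by apply: le_trans h (le_trans (vp k) _); rewrite lerD2l ltW.
  apply: ltW; apply: le_lt_trans h1; rewrite sub0r normrN.
  exact: ler_norm.
exists c, m; split => // y r by_.
apply/ler_addgt0Pr => delta d0.
have := mle (_, _) (mid _ _ _ _ by_ (ballc _ d0)); rewrite /=; lra.
Qed.

End AsymptoticCenter.

(* The weak limit is the common asymptotic centre of the subsequences; it is a
   zero of [F] because [Id - F] is nonexpansive. *)
Lemma weak_convergence_zero (F : H -> H) (x : nat -> H) :
  (forall a b, dot (F a - F b) (F a - F b) / 2 <= dot (a - b) (F a - F b)) ->
  (exists z, F z = 0) ->
  (fun n => dot (F (x n)) (F (x n))) @ \oo --> 0 ->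
  (forall z, F z = 0 -> exists d : R,
    (fun n => dot (x n - z) (x n - z)) @ \oo --> d) ->
  exists2 c, F c = 0 & weakly_converges dot x c.
Proof.
move=> hF [z Fz] Fx hx.
have center P : (forall N, exists2 n, (N <= n)%N & P n) -> exists c m,
    [/\ F c = 0, forall delta, 0 < delta ->
      \forall n \near \oo, P n -> dot (x n - c) (x n - c) <= m + delta
    & forall y r, (\forall n \near \oo, P n -> dot (x n - y) (x n - y) <= r) ->
        m + dot (y - c) (y - c) / 2 <= r].
  move=> freqP; have [|c [m [m0 hc hm]]] := asymptotic_center (x := x) freqP.
    have [d hd] := hx _ Fz; exists z, (d + 1).
    move/cvgrPdist_lt : hd => /(_ _ ltr01); apply: filterS => n.
    by rewrite ltr_norml => /andP[? _] _; lra.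
  exists c, m; split => //.
  (* As [F (x n)] tends to 0 and [Id - F] is nonexpansive, [c - F c] is as good a centre as [c];
     quadratic growth then forces [F c = 0]. *)
  have growth : m + dot (F c) (F c) / 2 <= m.
    apply/ler_addgt0Pr => delta d0.
    have -> : F c = - (c - F c - c) by rewrite addrAC subrr sub0r opprK.
    rewrite dotNl dotNr opprK; apply: hm.
    have [e e0 he] := dot_perturb m0 d0.
    move/cvgrPdist_lt : Fx => /(_ _ e0).
    apply: filterS2 (hc _ e0) => n h1 h2 Pn.
    have -> : x n - (c - F c) = (x n - c - (F (x n) - F c)) + F (x n).
      by apply: dot_ext => w; rewrite !dotE; lra.
    apply: he.
      apply: le_trans (h1 Pn); move: (hF (x n) c).
      move: (x n - c) (F (x n) - F c) => u v.
      by rewrite !dotE (dotC v u); lra.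
    apply: ltW; apply: le_lt_trans h2; rewrite sub0r normrN.
    exact: ler_norm.
  by apply: dot_eq0; lra.
have [|c [m [Fc hc hm]]] := center (fun=> True); first by move=> N; exists N.
exists c => //.
have [d hd] := hx _ Fc.
have near_d e : 0 < e ->
    \forall n \near \oo, `|d - dot (x n - c) (x n - c)| < e.
  by move: e; apply/cvgrPdist_lt.
(* One-sided bounds for [y] and [- y] suffice. If one fails, the indices where it fails have their
   own asymptotic centre [c']. *)
have half y e : 0 < e -> \forall n \near \oo, dot (x n - c) y < e.
  move=> e0; apply: contrapT => nnear.
  pose P n := e <= dot (x n - c) y.
  have freqP N : exists2 n, (N <= n)%N & P n.
    apply: contrapT => nex; apply: nnear; exists N => // n /= Nn.
    by rewrite ltNge; apply/negP => Pn; apply: nex; exists n.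
  have [c' [m' [Fc' hc' hm']]] := center P freqP.
  have [d' hd'] := hx _ Fc'.
  have near_d' r : 0 < r ->
      \forall n \near \oo, `|d' - dot (x n - c') (x n - c')| < r.
    by move: r; apply/cvgrPdist_lt.
  (* The chain [d <= m <= d' <= m'] shows that [c] is also optimal along [P], whence [c = c'] by
     quadratic growth. *)
  have dm : d <= m.
    apply/ler_addgt0Pr => r r0; have r2 : 0 < r / 2 by rewrite divr_gt0.
    have [N _ HN] := filterI (near_d _ r2) (hc _ r2).
    have [/= + /(_ I)] := HN N (leqnn N).
    by rewrite ltr_norml => /andP[_ ?]; lra.
  have md' : m <= d'.
    apply/ler_addgt0Pr => r r0.
    apply: le_trans (hm c' (d' + r) _).
      by rewrite lerDl divr_ge0 ?dot_ge0.
    apply: filterS (near_d' _ r0) => n; rewrite ltr_norml => /andP[? _] _; lra.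
  have dm' : d' <= m'.
    apply/ler_addgt0Pr => r r0; have r2 : 0 < r / 2 by rewrite divr_gt0.
    have [N _ HN] := filterI (near_d' _ r2) (hc' _ r2).
    have [n Nn Pn] := freqP N.
    have [/= + /(_ Pn)] := HN n Nn.
    by rewrite ltr_norml => /andP[_ ?]; lra.
  have cc' : c = c'.
    apply/eqP; rewrite -subr_eq0; apply/eqP/dot_eq0.
    suff : m' + dot (c - c') (c - c') / 2 <= m' by lra.
    apply/ler_addgt0Pr => r r0; apply: hm'.
    apply: filterS (near_d _ r0) => n; rewrite ltr_norml => /andP[? _] _; lra.
  (* Along [P], moving the centre from [c] to [c + t y] lowers the squared radius by at least
     [2 t e], up to [t^2 |y|^2]. For small [t] this contradicts the optimality of [c]. *)
  suff : 0 <= - (2 * e) by lra.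
  apply: (@ge0_of_affine _ _ (dot y y / 2)) => t /andP[t0 _].
  rewrite -(ler_pM2l t0) mulr0.
  apply/ler_addgt0Pr => r r0.
  have /hm' : \forall n \near \oo, P n ->
      dot (x n - (c + t *: y)) (x n - (c + t *: y))
        <= d + r - 2 * t * e + t ^+ 2 * dot y y.
    apply: filterS (near_d _ r0) => n; rewrite ltr_norml => /andP[hn _] Pn.
    have := ler_wpM2l (ltW t0) Pn; move: hn; rewrite opprD addrA.
    move: (x n - c) => u; rewrite !dotE (dotC y u); lra.
  by rewrite -cc' [c + _]addrC addrK !dotE; lra.
move=> y; apply/cvgrPdist_lt => e e0.
apply: filterS2 (half y e e0) (half (- y) e e0) => n.
by rewrite !dotE ltr_norml => ? ?; lra.
Qed.

(** * The momentum iteration *)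

(** Exact one-step change of the energy, with [W = k D_k], [D = D_(k+1)], [f = F x_k] and
    [phi = F x_k - F x_(k-1)]. The hypothesis is the recurrence solved for [k D_k], so both sides
    become polynomials in inner products of [X], [D], [f], [phi]. *)
Lemma energy_step (alpha l k : R) (X D f phi W : H) :
  W = (k + alpha) *: D + (alpha / 2) *: f + k *: phi ->
  let E X W V := 2 * l * ((alpha - 1) * dot X X + 2 * dot X (W + V))
    + (dot (2 *: W + V) (2 *: W + V) + dot V V) / 2 in
  let eps := alpha - 1 - l in
  E (X + D) ((k + 1) *: D) ((k + 1) *: f) - E X W (k *: (f - phi))
  = - (2 * l * (alpha - 2)) * dot X f
    - k * (4 * eps * dot D D + 4 * eps * dot D f + (alpha - 2) * dot f f)
    - (4 * eps + 2 * l * eps + 2 * eps ^+ 2) * dot D D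
    - (2 * (alpha - 1) + 2 * eps + 2 * eps * (alpha - 1) + 2 * l * (alpha - 2))
      * dot D f
    + (3 / 2 - alpha - (alpha - 1) ^+ 2 / 2) * dot f f
    - 2 * k * dot W phi + k ^+ 2 * dot phi phi.
Proof.
move=> -> /=; rewrite !dotE.
rewrite ?(dotC D X) ?(dotC f D) ?(dotC phi D) ?(dotC phi f) ?(dotC f X).
rewrite ?(dotC phi X).
by field.
Qed.

Section Momentum.
Variables (F : H -> H) (alpha : R) (x : nat -> H).
Hypothesis hF :
  forall a b, dot (F a - F b) (F a - F b) / 2 <= dot (a - b) (F a - F b).
Hypothesis alpha2 : 2 < alpha.
Hypothesis hx : forall n,
  (n.+1%:R + alpha) *: (x n.+2 - x n.+1) = n.+1%:R *: (x n.+1 - x n)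
    - (alpha / 2) *: F (x n.+1) - n.+1%:R *: (F (x n.+1) - F (x n)).

(** Indices are shifted: at [n] these refer to [k = n + 1], with [W = k D_k], [V = k F x_(k-1)] and
    [quad = h_k]; below, [cross] is [p_k] and [energy l] is [E_l(k)]. *)
Let W n := n.+1%:R *: (x n.+1 - x n).
Let V n := n.+1%:R *: F (x n).
Let quad n := (dot (2 *: W n + V n) (2 *: W n + V n) + dot (V n) (V n)) / 2.

Section Zero.
Variable z : H.
Hypothesis Fz : F z = 0.

Let X n := x n.+1 - z.
Let cross n := (alpha - 1) * dot (X n) (X n) + 2 * dot (X n) (W n + V n).
Let energy l n := 2 * l * cross n + quad n.

Let F_cocoercive_zero a : dot (F a) (F a) / 2 <= dot (a - z) (F a).
Proof. by have := hF a z; rewrite Fz subr0. Qed.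

(** In [energy_step] the terms in [phi] are nonpositive, by cocoercivity between consecutive
    iterates. *)
Let energy_succ l n eps D f : eps = alpha - 1 - l ->
  D = x n.+2 - x n.+1 -> f = F (x n.+1) ->
  energy l n.+1 <= energy l n
    - (2 * l * (alpha - 2)) * dot (X n) f
    - n.+1%:R * (4 * eps * dot D D + 4 * eps * dot D f + (alpha - 2) * dot f f)
    - (4 * eps + 2 * l * eps + 2 * eps ^+ 2) * dot D D
    - (2 * (alpha - 1) + 2 * eps + 2 * eps * (alpha - 1) + 2 * l * (alpha - 2))
      * dot D f
    + (3 / 2 - alpha - (alpha - 1) ^+ 2 / 2) * dot f f.
Proof.
move=> heps hD hf; pose phi := f - F (x n); pose k : R := n.+1%:R.
have k0 : 0 <= k by [].
have eW : W n = (k + alpha) *: D + (alpha / 2) *: f + k *: phi.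
  by rewrite hD hx /W -/k -hf -/phi addrAC !addrNK.
have := energy_step l (X n) eW.
have -> : X n + D = X n.+1 by rewrite /X hD addrC addrA addrNK.
have -> : (k + 1) *: D = W n.+1 by rewrite /k natr1 ?hD ?hf.
have -> : (k + 1) *: f = V n.+1 by rewrite /k natr1 ?hD ?hf.
have -> : k *: (f - phi) = V n by rewrite /phi subKr.
rewrite /= -/(cross n) -/(cross n.+1) -/(quad n) -/(quad n.+1).
rewrite -/(energy l n) -/(energy l n.+1) -heps => e.
have := hF (x n.+1) (x n); rewrite -hf -/phi => hphi.
have : k ^+ 2 * dot phi phi <= 2 * k * dot (W n) phi.
  by have := ler_wpM2l (sqr_ge0 k) hphi; rewrite /W dotZl -/k; lra.
move: e; rewrite -/k; lra.
Qed.

(** The range of [l] keeps [eps = alpha - 1 - l] between [delta / 4] and [delta / 2], where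
    [delta = alpha - 2]. The quadratic form carrying the factor [k] then dominates
    [delta / 4 * (|D|^2 + |f|^2)]. *)
Let energy_decrease l : 1 + (alpha - 2) / 2 <= l <= 1 + 3 * (alpha - 2) / 4 ->
  exists N : nat, forall n, (N <= n)%N ->
    energy l n.+1 <= energy l n - (alpha - 2) / 128 * quad n.+1 / n.+1%:R.
Proof.
set delta := alpha - 2 => /andP[l1 l2].
have d0 : 0 < delta by rewrite subr_gt0.
have ed : alpha = 2 + delta by rewrite addrC subrK.
clearbody delta.
pose eps := alpha - 1 - l.
pose r1 := - (4 * eps + 2 * l * eps + 2 * eps ^+ 2).
pose r2 := - (2 * (alpha - 1) + 2 * eps + 2 * eps * (alpha - 1)
  + 2 * l * (alpha - 2)).
pose r3 := 3 / 2 - alpha - (alpha - 1) ^+ 2 / 2.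
(* From this rank on, half of the dominant form absorbs the terms [r1], [r2], [r3], which lack the
   factor [k]. *)
have [N _ HN] :=
  nbhs_infty_ger ((`|r1| + `|r2| + `|r3|) / (delta / 8)).
exists N => n nN; have := HN n nN; rewrite ler_pdivrMr; last lra.
move=> {HN nN} hn.
set D := x n.+2 - x n.+1; set f := F (x n.+1).
have := @energy_succ l n eps D f erefl erefl erefl.
have Xf : 0 <= 2 * l * (alpha - 2) * dot (X n) f.
  rewrite mulr_ge0 //; first by nra.
  apply: le_trans (F_cocoercive_zero _); have := dot_ge0 f; lra.
have : quad n.+1 = (dot (2 *: (n.+2%:R *: D) + n.+2%:R *: f)
  (2 *: (n.+2%:R *: D) + n.+2%:R *: f) + dot (n.+2%:R *: f) (n.+2%:R *: f)) / 2.
  by [].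
move: (quad n.+1) Xf => Q Xf eQ; move: D f eQ Xf => D f eQ Xf.
have k1 : 1 <= n.+1%:R :> R by rewrite ler1n.
have hk : `|r1| + `|r2| + `|r3| <= n.+1%:R * (delta / 8).
  by apply: le_trans hn _; rewrite ler_wpM2r ?ler_nat //; lra.
(* Here [Q] carries the weight [(k + 1)^2 <= 4 k^2]. The remaining [k * delta / 8] divided by 16
   yields the constant [delta / 128]. *)
have hq : Q / n.+1%:R <= 16 * (n.+1%:R * (dot D D + dot f f)).
  rewrite ler_pdivrMr ?ltr0n // eQ -[n.+2%:R]natr1.
  move: (n.+1%:R : R) k1 => k k1.
  have := dot_ge0 (2 *: D - f); have := dot_ge0 (2 *: D + f).
  have := dot_ge0 f.
  rewrite !dotE (dotC f D) => h1 h2 h3.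
  have kk : (k + 1) ^+ 2 <= 4 * k ^+ 2 by nra.
  have : (k + 1) ^+ 2 * (4 * dot D D + 4 * dot D f + 2 * dot f f)
      <= 4 * k ^+ 2 * (8 * dot D D + 3 * dot f f).
    apply: ler_pM => //; [exact: sqr_ge0|lra|lra].
  have : 0 <= k ^+ 2 * dot f f by rewrite mulr_ge0 ?sqr_ge0.
  lra.
move: (n.+1%:R : R) k1 hk hq => k k1 hk hq h.
apply: (le_trans h).
have DD := dot_ge0 D; have ff := dot_ge0 f.
have s1 : - dot D D <= 2 * dot D f + dot f f.
  by have := dot_ge0 (D + f); rewrite !dotE (dotC f D); lra.
have s2 : 2 * dot D f <= dot D D + dot f f.
  by have := dot_ge0 (D - f); rewrite !dotE (dotC f D); lra.
have s3 : 0 <= 4 * dot D D + 4 * dot D f + dot f f.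
  by have := dot_ge0 (2 *: D + f); rewrite !dotE (dotC f D); lra.
have m1 : r1 * dot D D <= `|r1| * dot D D by rewrite ler_wpM2r // ler_norm.
have m3 : r3 * dot f f <= `|r3| * dot f f by rewrite ler_wpM2r // ler_norm.
have m2 : r2 * dot D f <= `|r2| * (dot D D + dot f f).
  apply: le_trans (ler_norm _) _; rewrite normrM ler_wpM2l // ler_norml.
  by apply/andP; split; lra.
have m4 : (`|r1| + `|r2| + `|r3|) * (dot D D + dot f f)
    <= k * (delta / 8) * (dot D D + dot f f).
  by rewrite ler_wpM2r // addr_ge0.
have m5 : r1 * dot D D + r2 * dot D f + r3 * dot f f
    <= k * (delta / 8) * (dot D D + dot f f).
  apply: le_trans m4; move: m1 m2 m3 (mulr_ge0 (normr_ge0 r1) ff).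
  by move: (mulr_ge0 (normr_ge0 r3) DD); lra.
have q1 : delta / 4 * (dot D D + dot f f)
    <= 4 * eps * dot D D + 4 * eps * dot D f + (alpha - 2) * dot f f.
  have : delta * (4 * dot D D + 4 * dot D f + dot f f)
      <= 4 * eps * (4 * dot D D + 4 * dot D f + dot f f).
    by rewrite ler_wpM2r //; rewrite /eps; lra.
  have : eps * dot f f <= delta / 2 * dot f f.
    by rewrite ler_wpM2r //; rewrite /eps; lra.
  have := mulr_ge0 (ltW d0) DD; have := mulr_ge0 (ltW d0) ff.
  have := mulr_ge0 (ltW d0) (dot_ge0 (D + f)).
  rewrite ed !dotE (dotC f D); lra.
have q2 := ler_wpM2l (le_trans ler01 k1) q1.
move: m5 q2 hq; rewrite /r1 /r2 /r3.
rewrite -[_ / 128 * _ / k]mulrA.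
move=> m5 q2 /(ler_wpM2l (ltW (divr_gt0 d0 (ltr0n _ 128)))).
lra.
Qed.
(** Completing the square [|2 l X + 2 W + V + l F x_(k-1)|^2 / 2], the terms pairing [F x_(k-1)]
    with [x_(k-1) - z] are handled by cocoercivity. Young's inequality absorbs the leftover
    [<X, F x_(k-1)>], at the price of a multiple of [|F x_(k-1)|^2] that [k^2] eventually
    outweighs. *)
Let energy_ge l : 1 <= l < alpha - 1 ->
  exists N : nat, forall n, (N <= n)%N ->
    l * (alpha - 1 - l) * dot (X n) (X n) <= energy l n.
Proof.
move=> /andP[l1 la]; set eps := alpha - 1 - l.
have eps0 : 0 < eps by rewrite subr_gt0.
have ea : alpha - 1 = l + eps by rewrite [RHS]addrC subrK.
have [N _ HN] := nbhs_infty_ger (l ^+ 2 + 2 * (l ^+ 3 / eps)).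
exists N => n /HN hn; clear HN.
have {hn}hn : l ^+ 2 + 2 * (l ^+ 3 / eps) <= n.+1%:R ^+ 2.
  apply: (le_trans hn); rewrite -natrX ler_nat.
  by rewrite (leq_trans (leqnSn n)) // -mulnn leq_pmulr.
have hc := F_cocoercive_zero (x n).
have := dot_ge0 (2 * l *: X n + 2 *: W n + V n + l *: F (x n)).
have := dot_ge0 (eps *: X n - l *: F (x n)).
have hW : X n - n.+1%:R^-1 *: W n = x n - z.
  rewrite /W scalerA mulVf ?pnatr_eq0 // scale1r /X.
  by rewrite opprB addrC addrA addrNK.
rewrite /energy /cross /quad ea /V.
have k0 : 0 < n.+1%:R :> R by [].
move: hc; rewrite -hW; clearbody eps; clear hW.
move: (X n) (W n) (F (x n)) (n.+1%:R : R) hn k0 => x' w f k hn k0.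
move=> hc h1 h2.
have {}hc : k * dot f f / 2 <= k * dot x' f - dot w f.
  move: hc; rewrite !dotE -(ler_pM2l k0) mulrDr mulrN mulVKf ?gt_eqF //.
  lra.
have {}h1 : 2 * l ^+ 2 * dot x' f
    <= l * eps * dot x' x' + l ^+ 3 / eps * dot f f.
  have -> : l ^+ 3 / eps * dot f f = l * (l * (l * dot f f)) / eps.
    by field; rewrite gt_eqF.
  rewrite -(ler_pM2l eps0) mulrDr [eps * (_ / eps)]mulrC divfK ?gt_eqF //.
  have l0 : 0 <= l by lra.
  by move: (mulr_ge0 l0 h1); rewrite !dotE (dotC f x'); lra.
have := ler_wpM2r (dot_ge0 f) hn.
have := ler_wpM2l (le_trans ler01 l1) hc.
move: h1 h2; rewrite !dotE (dotC f x') (dotC f w) (dotC w x').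
move: (l ^+ 3 / eps) (dot x' x') (dot w w) (dot f f) => *; lra.
Qed.

Let energy_cvg l : 1 + (alpha - 2) / 2 <= l <= 1 + 3 * (alpha - 2) / 4 ->
  exists e : R, energy l @ \oo --> e.
Proof.
move=> hl; have [N1 h1] := energy_decrease hl.
have [|N2 h2] := @energy_ge l.
  by move/andP: hl => [? ?]; move: alpha2; lra.
apply: (@eventually_nonincreasing_cvg _ _ (maxn N1 N2)) => n.
all: rewrite geq_max => /andP[n1 n2].
  apply: le_trans (h1 _ n1) _; rewrite gerBl.
  apply: mulr_ge0; last by rewrite invr_ge0.
  apply: mulr_ge0; first by apply: divr_ge0 => //; rewrite subr_ge0 ltW.
  by apply: mulr_ge0 => //; rewrite addr_ge0 ?dot_ge0.
apply: le_trans (h2 _ n2); rewrite !mulr_ge0 ?dot_ge0 //.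
all: by move/andP: hl => [? ?]; move: alpha2; lra.
Qed.

Lemma momentum_cvg : quad @ \oo --> 0 /\
  exists d : R, (fun n => dot (X n) (X n)) @ \oo --> d.
Proof.
pose delta := alpha - 2; have d0 : 0 < delta by rewrite subr_gt0.
pose l1 := 1 + delta / 2; pose l2 := 1 + 3 * delta / 4.
have hl1 : 1 + (alpha - 2) / 2 <= l1 <= 1 + 3 * (alpha - 2) / 4.
  by rewrite /l1 -/delta; lra.
have hl2 : 1 + (alpha - 2) / 2 <= l2 <= 1 + 3 * (alpha - 2) / 4.
  by rewrite /l2 -/delta; lra.
have [e1 he1] := energy_cvg hl1; have [e2 he2] := energy_cvg hl2.
have dl : l2 - l1 != 0 by rewrite gt_eqF // /l1 /l2; lra.
have eq_quad :
    quad = fun n => (l2 * energy l1 n - l1 * energy l2 n) / (l2 - l1).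
  by apply/funext => n; rewrite /energy; field.
have eq_cross : cross = fun n => (energy l2 n - energy l1 n) / (2 * (l2 - l1)).
  by apply/funext => n; rewrite /energy; field.
have quadL : quad @ \oo --> (l2 * e1 - l1 * e2) / (l2 - l1).
  by rewrite eq_quad; apply: cvgMl; apply: cvgB; exact: cvgMr.
have crossL : cross @ \oo --> (e2 - e1) / (2 * (l2 - l1)).
  by rewrite eq_cross; apply: cvgMl; exact: cvgB.
have quad0 : quad @ \oo --> 0.
  have [N hN] := energy_decrease hl1.
  apply: (@harmonic_decrease_cvg0 _ (energy l1) _ (delta / 128)
    _ _ N _ _ hN he1 quadL).
    by rewrite divr_gt0.
  by move=> n; rewrite /quad mulr_ge0 ?addr_ge0 ?dot_ge0.
split => //.
(* A convergent energy is bounded, so [energy_ge] bounds the iterates. *)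
have [b b0 hb] : exists2 b, 0 < b & \forall n \near \oo, dot (X n) (X n) <= b.
  have [|N hN] := @energy_ge l1; first by rewrite /l1 /delta; move: alpha2; lra.
  pose c := l1 * (alpha - 1 - l1).
  have c0 : 0 < c by rewrite /c mulr_gt0 ?subr_gt0 // /l1 /delta; lra.
  exists ((`|e1| + 1) / c); first by rewrite divr_gt0 // ltr_wpDl.
  have he1' : \forall n \near \oo, `|e1 - energy l1 n| < 1.
    by move/cvgrPdist_lt : he1; apply.
  near=> n; rewrite ler_pdivlMr // mulrC; apply: le_trans (hN n _) _.
    by near: n; exact: nbhs_infty_ge.
  have : `|e1 - energy l1 n| < 1 by near: n.
  by rewrite ltr_norml => /andP[? _]; have := ler_norm e1; lra.
(* Cauchy-Schwarz with [quad = |W|^2 + |W + V|^2]; [cross] then reduces in the limit to its [|X|^2]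
   term. *)
have inner0 : (fun n => dot (X n) (W n + V n)) @ \oo --> 0.
  apply/cvgrPdist_lt => e e0.
  have e20 : 0 < e ^+ 2 / b by rewrite divr_gt0 ?exprn_gt0.
  move/cvgrPdist_lt : quad0 => /(_ _ e20) quad0.
  near=> n; rewrite sub0r normrN -(@ltr_pXn2r _ 2%N) ?nnegrE ?(ltW e0) //.
  rewrite real_normK ?num_real //; apply: le_lt_trans (dot_sqr_le _ _) _.
  have hq : dot (W n + V n) (W n + V n) <= quad n.
    rewrite /quad; move: (W n) (V n) => w v; have := dot_ge0 w.
    by rewrite !dotE (dotC v w); lra.
  have Xb : dot (X n) (X n) <= b by near: n.
  have : `|0 - quad n| < e ^+ 2 / b by near: n; exact: quad0.
  rewrite sub0r normrN => /(le_lt_trans (ler_norm _)).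
  rewrite ltr_pdivlMr // mulrC; apply: le_lt_trans.
  by rewrite ler_pM ?dot_ge0.
exists (((e2 - e1) / (2 * (l2 - l1)) - 2 * 0) / (alpha - 1)).
have -> : (fun n => dot (X n) (X n)) =
    fun n => (cross n - 2 * dot (X n) (W n + V n)) / (alpha - 1).
  apply/funext => n; rewrite /cross addrK mulrC mulKf // gt_eqF //.
  by move: alpha2; lra.
by apply: cvgMl; apply: cvgB => //; exact: cvgMr.
Unshelve. all: by end_near.
Qed.

End Zero.
Lemma momentum_convergence : (exists z, F z = 0) ->
  [/\ exists2 c, F c = 0 & weakly_converges dot x c,
      (fun n => n.+1%:R * `|x n.+1 - x n|) @ \oo --> 0
    & (fun n => n.+1%:R * `|F (x n)|) @ \oo --> 0].
Proof.
move=> exz; have [z Fz] := exz; have [quad0 _] := momentum_cvg Fz.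
(* [W], [V] and [F (x n)] are all dominated by [quad], the last because its weight [n + 1] in [V] is
   at least 1. *)
have cvg0 (u : nat -> H) : (forall n, dot (u n) (u n) <= 2 * quad n) ->
    (fun n => `|u n|) @ \oo --> 0.
  move=> uq; apply/cvgrPdist_lt => e e0.
  have e2 : 0 < e ^+ 2 / 2 by rewrite divr_gt0 ?exprn_gt0.
  move/cvgrPdist_lt : quad0 => /(_ _ e2); apply: filterS => n.
  rewrite !sub0r !normrN normr_id norm_lt_dot // => h.
  by apply: le_lt_trans (uq n) _; have := le_lt_trans (ler_norm _) h; lra.
have V2 n : dot (V n) (V n) <= 2 * quad n.
  rewrite /quad; move: (W n) (V n) => w v.
  by have := dot_ge0 (2 *: w + v); lra.
have W2 n : dot (W n) (W n) <= 2 * quad n.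
  rewrite /quad; move: (W n) (V n) => w v.
  have := dot_ge0 w; have := dot_ge0 (w + v).
  by rewrite !dotE (dotC v w); lra.
have F2 n : dot (F (x n)) (F (x n)) <= 2 * quad n.
  apply: le_trans (V2 n); rewrite /V dotZl dotZr mulrA.
  by rewrite ler_peMl ?dot_ge0 // -natrM ler1n.
split.
- apply: weak_convergence_zero => //.
    have -> : (fun n => dot (F (x n)) (F (x n))) =
        (fun n => `|F (x n)|) \* (fun n => `|F (x n)|).
      by apply/funext => n; rewrite hdot expr2.
    by have := cvgM (cvg0 _ F2) (cvg0 _ F2); rewrite mulr0; apply.
  move=> y Fy; have [_ [d hd]] := momentum_cvg Fy; exists d.
  by rewrite -(cvg_shiftS (fun n => dot (x n - y) (x n - y))).
- rewrite [X in X @ _](_ : _ = fun n => `|W n|); first exact: cvg0.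
  by apply/funext => n; rewrite /W normrZ normr_nat.
- rewrite [X in X @ _](_ : _ = fun n => `|V n|); first exact: cvg0.
  by apply/funext => n; rewrite /V normrZ normr_nat.
Qed.

End Momentum.

(** * From the inclusion problem to the momentum iteration *)

(** Supplies the hypothesis of [T_DY_cocoercive] with [kappa = s / 2]. For finite [beta], expanding
    [|c - g / (2 beta)|^2] bounds [gamma <g, c>] by [gamma beta |c|^2 + gamma / (4 beta) |g|^2], and
    the bound on [s] says [gamma / (4 beta) <= 1 - s / 2]. For [+oo], [C] vanishes and the bound
    reads [s <= 2]. *)
Lemma cocoercive_quadratic (C : H -> H) (beta : \bar R) (gamma s : R) :
  cocoercive dot beta C -> (0%:E < beta)%E -> 0 < gamma ->
  (s%:E <= 2%:E - gamma%:E / (2%:E * beta))%E ->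
  forall x y g, 0 <= (1 - s / 2) * dot g g
    + gamma * (dot (x - y) (C x - C y) - dot g (C x - C y)).
Proof.
move=> hC b0 g0 hs x y g; case: beta b0 hC hs => [b| |] //=.
- rewrite lte_fin => b0 /(_ x y); rewrite -hdot => hC.
  have b2 : 0 < 2 * b by rewrite mulr_gt0.
  rewrite -EFinM inver gt_eqF // -EFinM -EFinB lee_fin => hs.
  move: (C x - C y) hC => c hC.
  have h := dot_ge0 (c - (2 * b)^-1 *: g).
  have h1 : (2 * b)^-1 * (gamma / 2) * dot g g <= (1 - s / 2) * dot g g.
    rewrite ler_wpM2r ?dot_ge0 //.
    by move: (_^-1) hs => i hs; lra.
  have h2 := ler_wpM2l (ltW g0) hC.
  have h3 : gamma * (b * dot (c - (2 * b)^-1 *: g) (c - (2 * b)^-1 *: g)) =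
      gamma * b * dot c c - gamma * dot g c
      + (2 * b)^-1 * (gamma / 2) * dot g g.
    by rewrite !dotE (dotC c g); field; rewrite gt_eqF.
  have := mulr_ge0 (ltW g0) (mulr_ge0 (ltW b0) h); rewrite h3; lra.
- move=> _ C0; rewrite gt0_muley ?lte_fin // invey mule0 sube0 lee_fin => hs.
  rewrite !C0 subrr !dot0r subrr mulr0 addr0 mulr_ge0 ?dot_ge0 //; lra.
Qed.

(** Clearing the denominator [k + alpha] makes the iteration depend on [T] only through
    [s (Id - T)]. *)
Lemma relaxed_recurrence (T : H -> H) (alpha s k : R) (a b c : H) :
  k + alpha != 0 ->
  c = (1 - s * alpha / (2 * (k + alpha))) *: b
    + ((1 - s) * k / (k + alpha)) *: (b - a)
    + (s * alpha / (2 * (k + alpha))) *: T b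
    + (s * k / (k + alpha)) *: (T b - T a) ->
  (k + alpha) *: (c - b) = k *: (b - a) - (alpha / 2) *: (s *: (b - T b))
    - k *: (s *: (b - T b) - s *: (a - T a)).
Proof.
move=> ka ->; apply: dot_ext => w; rewrite !dotE.
by field.
Qed.

End InnerProduct.

Theorem corollary4p1 (R : realType) (H : completeNormedModType R)
    (dot : {dot H for idfun}) (hdot : induces_norm dot)
    (A B : H -> set H) (C : H -> H) (beta : \bar R)
    (hA : maximally_monotone dot A) (hB : maximally_monotone dot B)
    (hbeta : (0%:E < beta)%E) (hC : cocoercive dot beta C)
    (hsol : exists z : H, solution A B C z)
    (alpha gamma s : R) (halpha : 2 < alpha)
    (hgamma0 : 0 < gamma) (hgamma : (gamma%:E <= 2%:E * beta)%E)
    (hs0 : 0 < s) (hs : (s%:E <= 2%:E - gamma%:E / (2%:E * beta))%E)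
    (x0 x1 : H) (x : nat -> H) (hx0 : x 0%N = x0) (hx1 : x 1%N = x1)
    (hx : forall k : nat, (1 <= k)%N ->
       x k.+1 =
         (1 - s * alpha / (2 * (k%:R + alpha))) *: x k
         + ((1 - s) * k%:R / (k%:R + alpha)) *: (x k - x k.-1)
         + (s * alpha / (2 * (k%:R + alpha))) *: T_DY gamma A B C (x k)
         + (s * k%:R / (k%:R + alpha))
             *: (T_DY gamma A B C (x k) - T_DY gamma A B C (x k.-1))) :
  (exists xs : H,
     [/\ weakly_converges dot x xs,
         xs = T_DY gamma A B C xs
       & solution A B C (resolvent gamma B xs)])
  /\ (is_o_inv (fun k => `|x k - x k.-1|)
      /\ is_o_inv (fun k => `|x k.-1 - T_DY gamma A B C (x k.-1)|)).
Proof.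
pose T := T_DY gamma A B C; pose F a := s *: (a - T a).
(* Cocoercivity of [Id - T] with constant [s / 2], multiplied by [s], becomes constant [1 / 2] for
   [F]. *)
have hF a b : dot (F a - F b) (F a - F b) / 2 <= dot (a - b) (F a - F b).
  have := T_DY_cocoercive hdot hA hB hgamma0
    (cocoercive_quadratic hdot hC hbeta hgamma0 hs) a b.
  rewrite -/T /F -scalerBr; move: (_ - _ - _) => g h.
  rewrite dotZl !dotZr; have := ler_wpM2l (ltW hs0) h; lra.
have fixF z : F z = 0 <-> z = T z.
  rewrite /F; split => [/eqP|<-]; last by rewrite subrr scaler0.
  by rewrite scaler_eq0 gt_eqF //= subr_eq0 => /eqP.
have exz : exists z, F z = 0.
  have [p /(solution_T_DY_fixed hdot hA hB hgamma0)[z hz]] := hsol.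
  by exists z; apply/fixF.
have rec n : (n.+1%:R + alpha) *: (x n.+2 - x n.+1)
    = n.+1%:R *: (x n.+1 - x n)
      - (alpha / 2) *: F (x n.+1) - n.+1%:R *: (F (x n.+1) - F (x n)).
  apply: (relaxed_recurrence hdot); last exact: hx n.+1 isT.
  by rewrite gt_eqF // ltr_wpDl // (lt_trans _ halpha).
have [[c /fixF Tc xc] xo Fo] := momentum_convergence hdot hF halpha rec exz.
split; last split.
- exists c; split => //; exact: (T_DY_fixed_solution hdot hA hB hgamma0 Tc).
(* At [k = n + 1] the predecessor [k.-1] is [n], which matches the rates of the momentum
   iteration. *)
- by rewrite /is_o_inv -cvg_shiftS.
- have so : (fun n => s^-1 * (n.+1%:R * `|F (x n)|)) @ \oo --> s^-1 * 0.
    exact: cvgMr.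
  rewrite mulr0 in so; rewrite /is_o_inv -cvg_shiftS.
  have -> : (fun n => n.+1%:R * `|x n - T (x n)|)
      = fun n => s^-1 * (n.+1%:R * `|F (x n)|).
    apply/funext => n; rewrite /F normrZ gtr0_norm // mulrCA mulKf //.
    by rewrite gt_eqF.
  exact: so.
Qed.
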